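(* Let $p$ be a prime number and $k$ a positive integer. Then the number $N$ of isomorphism classes of indecomposable solutions of order $p^k$ with cyclic permutation group is equal to: \begin{itemize} \item $N=p^r+p^{r-1}-1$, for $p\neq 2$ and $k=2r\geq 2$; \item $N=2p^r-1$, for $p\neq 2$ and $k=2r+1\geq 3$; \item $N=2^r+2^{r-1}-2$, for $p=2$ and $k=2r\geq 4$; \item $N=2^{r+1}-2$, for $p=2$ and $k=2r+1\geq 3$. \end{itemize}
   Context: A solution is a nonempty set $X$ with maps $\sigma,\tau:X^2\to X$, written $\sigma_x(y)=\sigma(x,y)$, $\tau_y(x)=\tau(x,y)$, such that $r=(\sigma,\tau):X^2\to X^2$ satisfies $(\mathrm{id}\times r)(r\times \mathrm{id})(\mathrm{id}\times r)=(r\times \mathrm{id})(\mathrm{id}\times r)(r\times \mathrm{id})$, all $\sigma_x$ and $\tau_y$ are bijections of $X$, and $r^2=\mathrm{id}$. Its order is $|X|$. An isomorphism of solutions is a bijection $f$ with $f(\sigma_x(y))=\sigma'_{f(x)}(f(y))$ (it then also respects $\tau$). The permutation group of $X$ is $\mathcal{G}(X)=\langle\sigma_x : x\in X\rangle\le \mathrm{Sym}(X)$, and the solution is indecomposable if $\mathcal{G}(X)$ acts transitively on $X$. *)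

(* Defs.v *)
From mathcomp Require Import all_boot all_fingroup all_solvable.

Set Implicit Arguments.
Unset Strict Implicit.
Unset Printing Implicit Defensive.

Section Solutions.

Variable X : finType.

(* A pair of maps sigma, tau : X^2 -> X all of whose slices
     sigma_x = sigma(x, -)   and   tau_y = tau(-, y)
   are bijections, stored as the two families of permutations
   (sigma_x)_x and (tau_y)_y. Thus sigma(x, y) = [sg S x y], whereas
   tau(x, y) = [tu S y x], with the subscript first. *)
Definition nondeg_pair : Type := ({ffun X -> {perm X}} * {ffun X -> {perm X}})%type.

Implicit Type S : nondeg_pair.

Definition sg S (x : X) : {perm X} := S.1 x.
Definition tu S (y : X) : {perm X} := S.2 y.

Definition ybmap S (u : X * X) : X * X := (sg S u.1 u.2, tu S u.2 u.1).

Definition ybmap_x_id S (u : X * X * X) : X * X * X :=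
  let: (x, y, z) := u in (ybmap S (x, y), z).

Definition id_x_ybmap S (u : X * X * X) : X * X * X :=
  let: (x, y, z) := u in
  let: (y', z') := ybmap S (y, z) in (x, y', z').

Definition braided S : bool :=
  [forall u, id_x_ybmap S (ybmap_x_id S (id_x_ybmap S u))
          == ybmap_x_id S (id_x_ybmap S (ybmap_x_id S u))].

Definition involutive_pair S : bool := [forall u, ybmap S (ybmap S u) == u].

Definition solution S : bool :=
  [&& 0 < #|X|, braided S & involutive_pair S].

Definition permutation_group S : {group {perm X}} :=
  <<[set sg S x | x : X]>>%G.

Definition indecomposable S : bool :=
  [transitive permutation_group S, on [set: X] | 'P].

Definition isomorphic S S' : bool :=
  [exists f : {perm X}, forall x, forall y,
     f (sg S x y) == sg S' (f x) (f y)].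

Definition cyclic_indecomposable_solutions : {set nondeg_pair} :=
  [set S | [&& solution S, indecomposable S & cyclic (permutation_group S)]].

End Solutions.

(* Every solution of order n is isomorphic to one carried by 'I_n, so the
   isomorphism classes of solutions of order n are those of solutions on 'I_n. *)
Definition num_cyclic_indecomposable (n : nat) : nat :=
  #|equivalence_partition (@isomorphic 'I_n)
      (cyclic_indecomposable_solutions 'I_n)|.

(* [equivalence_partition] yields the equivalence classes only for an
   equivalence relation. *)
Lemma isomorphic_equiv (X : finType) : equivalence_rel (@isomorphic X).
Proof.
have isoP (S S' : nondeg_pair X) : reflect (exists f : {perm X}, forall x y,
    f (sg S x y) = sg S' (f x) (f y)) (isomorphic S S').
  apply: (iffP existsP) => -[f Hf]; exists f.
    by move=> x y; apply/eqP; move/forallP: Hf => /(_ x)/forallP/(_ y).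
  by apply/forallP => x; apply/forallP => y; rewrite Hf.
have refl (S : nondeg_pair X) : isomorphic S S.
  by apply/isoP; exists 1%g => x y; rewrite !perm1.
have sym (S S' : nondeg_pair X) : isomorphic S S' -> isomorphic S' S.
  move=> /isoP[f Hf]; apply/isoP; exists f^-1%g => x y.
  by apply: (@perm_inj _ f); rewrite Hf !permKV.
have trans (S S' S'' : nondeg_pair X) :
    isomorphic S S' -> isomorphic S' S'' -> isomorphic S S''.
  move=> /isoP[f Hf] /isoP[g Hg]; apply/isoP; exists (f * g)%g => x y.
  by rewrite !permM Hf Hg.
move=> S S' S''; split=> [|iSS']; first exact: refl.
by apply/idP/idP; apply: trans => //; apply: sym.
Qed.

(* Main.v *)
Require Import Defs.
From mathcomp Require Import all_boot all_algebra all_fingroup all_solvable.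
From mathcomp Require Import ring zify.

(** The permutation group of a cyclic indecomposable solution is abelian and
    transitive, hence regular, so the solution lives on Z/p^k with every
    sigma_x a translation y |-> y + s(x) ([cyclic_solution_translations]).  The
    braid relation then says exactly that the maps A_z : x |-> x + s(z - x)
    commute, and conjugation by x |-> x + 1 turns A_z into A_(z+1).  They
    therefore generate an abelian regular group normalised by a full cycle, and
    such a group is cyclic when p is odd or k > 2
    ([regular_abelian_cyclic]).  It is generated by A_0, and conjugation by
    x |-> x + 1 is raising to some power t.  Recording a point x by the exponent
    E(x) with A_0^E(x) (0) = x gives E(x) = w [x]_t, where
    [x]_t = 1 + t + ... + t^(x-1), and E(s(z)) = t^z, since A_z = A_0^(t^z)
    sends 0 to s(z).  So s is a discrete logarithm: it solves
    w [s(x)]_t = t^x ([translation_parameters]).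

    Surjectivity of E forces w to be a unit.  As x |-> x + 1 has order p^k, so
    that t^(p^k) = 1, Fermat's little theorem gives t = 1 mod p; for p = 2,
    surjectivity of E also excludes t = 3 mod 4.  For all such t the q-integer
    [x]_t has the same p-adic valuation as x ([dvdn_qnat]), so x |-> [x]_t is a
    bijection of Z/p^k and every such pair (t, w) comes from a solution ([exponential_solution_exists]).

    Isomorphisms between translation solutions are affine, y |-> a y + b, and
    act on the pairs by t = t'^a, w t'^b = [a]_t' w'
    ([isomorphic_exponentialP]).  Every admissible t is, for exactly one
    j <= k, a power of 1 + p^j with exponent prime to p, so t can be normalised
    to 1 + p^j.  The remaining freedom multiplies w by the powers of 1 + p^j,
    which are all the units that are 1 mod p^j, and by the [a]_t with t^a = t,
    which are the units that are 1 mod p^(k-j); hence w matters exactly modulo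
    p^min(j, k-j) ([level_isoP]).  The number of classes is the sum of
    totient (p^min(j, k-j)) over 1 <= j <= k, respectively 2 <= j <= k for
    p = 2, and both halves of this sum telescope. *)

Set Implicit Arguments.
Unset Strict Implicit.
Unset Printing Implicit Defensive.
Import GRing.Theory GroupScope.

(** * q-integers modulo prime powers *)

Section QNat.
Local Open Scope nat_scope.

Definition qnat (t d : nat) : nat := \sum_(i < d) t ^ i.

Lemma qnatD t a b : qnat t (a + b) = qnat t a + t ^ a * qnat t b.
Proof.
rewrite /qnat big_split_ord /= big_distrr /=; congr addn.
by apply: eq_bigr => i _; rewrite expnD.
Qed.

Lemma qnat1 t : qnat t 1 = 1.
Proof. by rewrite /qnat big_ord1. Qed.

Lemma qnat0 t : qnat t 0 = 0.
Proof. by rewrite /qnat big_ord0. Qed.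

Lemma qnatM t a b : qnat t (a * b) = qnat t a * qnat (t ^ a) b.
Proof.
elim: b => [|b IHb]; first by rewrite muln0 !qnat0 muln0.
rewrite mulnSr -addn1 !qnatD IHb qnat1 muln1 mulnDr -expnM; congr addn.
by rewrite mulnC.
Qed.

Lemma qnat_modn e t d : t = 1 %[mod e] -> qnat t d = d %[mod e].
Proof.
move=> t1; elim: d => [|d IHd]; first by rewrite qnat0.
rewrite -addn1 qnatD qnat1 muln1 -modnDm IHd -modnXm t1 modnXm exp1n.
by rewrite modnDm.
Qed.

(** The smallest l such that [x]_t and x have the same p-adic valuation for all
    t = 1 mod p^l: for p = 2 the residue 3 mod 4 is excluded, as [2]_3 = 4. *)
Definition unip_level (p : nat) : nat := (p == 2).+1.

Definition unipotent_mod (p t : nat) : Prop := t = 1 %[mod p ^ unip_level p].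

Lemma unipotent_modX p t a : unipotent_mod p t -> unipotent_mod p (t ^ a).
Proof. by rewrite /unipotent_mod => t1; rewrite -modnXm t1 modnXm exp1n. Qed.

Lemma unipotent_modW p t : unipotent_mod p t -> t = 1 %[mod p].
Proof.
rewrite /unipotent_mod /unip_level expnS => t1.
have := congr1 (modn^~ p) t1.
by rewrite !modn_dvdm ?dvdn_mulr.
Qed.

(** The valuation of [p]_t is exactly 1.  Modulo p^2, writing t = 1 + p v, the sum
    of the t^i is p + p v (p choose 2), and p divides the binomial when p is
    odd; for p = 2 the sum is 1 + t = 2 mod 4. *)
Lemma qnat_prime p t : prime p -> unipotent_mod p t ->
  exists2 u, qnat t p = p * u & coprime p u.
Proof.
move=> p_pr t1; have p_gt1 := prime_gt1 p_pr; have p_gt0 := ltnW p_gt1.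
suff qp : qnat t p = p %[mod p ^ 2].
  have /dvdnP[u qu] : p %| qnat t p.
    by rewrite /dvdn (qnat_modn p (unipotent_modW t1)) modnn.
  exists u; first by rewrite mulnC.
  have /eqP : p * u = p * 1 %[mod p * p] by rewrite mulnC -qu muln1 qp.
  rewrite -!muln_modr eqn_pmul2l // => /eqP u1.
  by rewrite prime_coprime // /dvdn u1 modn_small.
rewrite /unipotent_mod /unip_level in t1.
have [p2|p_neq2] := eqVneq p 2.
  rewrite p2 in t1 *; rewrite /qnat !big_ord_recl big_ord0.
  by rewrite /= expn0 expn1 addn0 -modnDmr t1 modnDmr.
rewrite (negPf p_neq2) expn1 in t1.
have t_gt0 : 0 < t by case: t t1 => //; rewrite mod0n modn_small.
have /dvdnP[v tv] : p %| t - 1 by rewrite -eqn_mod_dvd // t1.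
have tE : t = 1 + p * v by rewrite mulnC -tv subnKC.
have tX i : t ^ i = 1 + i * (p * v) %[mod p ^ 2].
  elim: i => [|i IHi] //; rewrite expnS -modnMmr IHi modnMmr {1}tE.
  rewrite (_ : _ * _ = 1 + i.+1 * (p * v) + i * v * v * p ^ 2); last by ring.
  by rewrite addnC modnMDl.
rewrite /qnat.
have -> : \sum_(i < p) t ^ i = \sum_(i < p) (1 + i * (p * v)) %[mod p ^ 2].
  by elim/big_rec2: _ => // i x y _ e; rewrite -modnDm tX e modnDm.
rewrite big_split /= sum1_card card_ord -big_distrl /=.
have /dvdnP[d dE] : p %| \sum_(i < p) i.
  rewrite -(big_mkord xpredT id) bin2_sum.
  by apply: prime_dvd_bin; rewrite //= ltn_neqAle eq_sym p_neq2.
by rewrite dE (_ : _ * _ = d * v * p ^ 2) ?[p + _]addnC ?modnMDl //; ring.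
Qed.

(** Induction on k through [p d]_t = [p]_t [d]_(t^p), where [p]_t contributes one
    factor p, and t^p is again unipotent. *)
Lemma dvdn_qnat p t k d : prime p -> unipotent_mod p t ->
  (p ^ k %| qnat t d) = (p ^ k %| d).
Proof.
move=> p_pr; have p_gt0 := prime_gt0 p_pr.
elim: k t d => [|k IHk] t d t1; first by rewrite !dvd1n.
have qd := qnat_modn d (unipotent_modW t1).
have [/dvdnP[d' ->]|pd] := boolP (p %| d); last first.
  have nd a : (p %| a) = false -> (p ^ k.+1 %| a) = false.
    by move=> na; apply: contraFF na; apply: dvdn_trans; rewrite expnS dvdn_mulr.
  by rewrite !nd ?(negPf pd) // /dvdn qd; apply/negbTE.
have [u qu cpu] := qnat_prime p_pr t1.
rewrite mulnC qnatM qu -mulnA expnS !dvdn_pmul2l // Gauss_dvdr; last first.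
  exact: coprimeXl.
exact/IHk/unipotent_modX.
Qed.

(** This rules out t = 3 mod 4 below: the residue 2 is not a q-integer. *)
Lemma qnat_mod4 t d : t = 3 %[mod 4] -> qnat t d = odd d %[mod 4].
Proof.
move=> t3; elim: d => [|d IHd]; first by rewrite qnat0.
rewrite -add1n qnatD qnat1 expn1 -modnDmr -modnMm t3 IHd /=.
by case: (odd d).
Qed.

End QNat.

(** * Abelian regular groups normalised by a full cycle *)

(** In an abelian transitive group, an element fixing x commutes with elements that
    move x anywhere, so it fixes everything. *)
Lemma transitive_abelian_semiregular (X : finType) (G : {group {perm X}}) h x :
  abelian G -> [transitive G, on [set: X] | 'P] -> h \in G -> h x = x -> h = 1.
Proof.
move=> cGG trG Gh hx; apply/permP => y; rewrite perm1.
have [g Gg ->] := atransP2 trG (in_setT x) (in_setT y).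
by rewrite /= apermE -permM -(centsP cGG _ Gh _ Gg) permM hx.
Qed.

Lemma transitive_abelian_card (X : finType) (G : {group {perm X}}) (x : X) :
  abelian G -> [transitive G, on [set: X] | 'P] -> #|G| = #|X|.
Proof.
move=> cGG trG; have <- := card_orbit_stab 'P G x.
rewrite (atransP trG) ?inE // cardsT.
suff -> : 'C_G[x | 'P] = 1 by rewrite cards1 muln1.
apply/trivgP/subsetP => h /setIP[Gh /astab1P hx]; apply/set1P.
exact: transitive_abelian_semiregular cGG trG Gh hx.
Qed.

(** Commutation with a p-group strictly lowers the order of a nontrivial normal
    subgroup, so [H, P] has order at most p and [[H, P], P] is trivial. *)
Lemma central_commutator_order_p2 (gT : finGroupType) (p : nat) (P H : {group gT}) :
  prime p -> p.-group P -> H <| P -> #|H| = (p ^ 2)%N -> [~: H, P] \subset 'C(P).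
Proof.
move=> p_pr pP nHP oH; have nilP := pgroup_nil pP.
have sHP := normal_sub nHP; have p_gt1 := prime_gt1 p_pr.
have ltK : [~: H, P] \proper H.
  apply: (nil_comm_properl nilP) => //; last by rewrite subsetI subxx normal_norm.
  by rewrite -cardG_gt1 oH (ltn_exp2l 0).
have dvdK : #|[~: H, P]| %| p.
  have: #|[~: H, P]| %| p ^ 2 by rewrite -oH cardSg ?proper_sub.
  case/(dvdn_pfactor _ _ p_pr) => [[|[|[|i]]]] // _ eqK; rewrite ?eqK ?dvdn1 //.
  by have := proper_card ltK; rewrite eqK oH ltnn.
apply/commG1P/eqP; apply: contraT => ntKP.
have ntK : [~: H, P] != 1 by apply: contraNneq ntKP => ->; rewrite comm1G.
have ltKP : [~: [~: H, P], P] \proper [~: H, P].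
  apply: (nil_comm_properl nilP) => //; last by rewrite subsetI subxx commg_normr.
  exact: subset_trans (proper_sub ltK) sHP.
have /(prime_nt_dvdP p_pr) eqKP : #|[~: [~: H, P], P]| %| p.
  exact: dvdn_trans (cardSg (proper_sub ltKP)) dvdK.
have := proper_card ltKP; rewrite eqKP -?trivg_card1 // ltnNge.
by rewrite dvdn_leq // prime_gt0.
Qed.

(** If A is not cyclic, it contains an elementary abelian subgroup H of order p^2
    that is normal in P = A <T>.  The orbit of a point x0 under H is a block, so
    it is also the orbit of x0 under the subgroup of order p^2 of <T>, generated
    by U = T^q with q = p^(k-2).  Write U = c a with a in H and c fixing x0.  As
    [a, c] is central in P, U^p = c^p a^p [a, c]^(p choose 2) = c^p: the last
    factor vanishes for p odd because H has exponent p, and for p = 2 and k > 2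
    because U is then a square in P, and squares centralise H.  So U^p fixes x0,
    although U has order p^2. *)
Lemma regular_abelian_cyclic (X : finType) (p k : nat) (A : {group {perm X}})
    (T : {perm X}) :
  prime p -> #|X| = (p ^ k)%N -> (p != 2) || (2 < k) ->
  abelian A -> [transitive A, on [set: X] | 'P] ->
  T \in 'N(A) -> [transitive <[T]>, on [set: X] | 'P] -> cyclic A.
Proof.
move=> p_pr oX hpk cAA trA nAT trT; have p_gt1 := prime_gt1 p_pr.
have [x0 _] : exists x0 : X, x0 \in [set: X].
  by apply/set0Pn; rewrite -card_gt0 cardsT oX expn_gt0 ltnW.
have cTT := cycle_abelian T.
have oA : #|A| = (p ^ k)%N by rewrite (transitive_abelian_card x0).
have oT : #[T] = (p ^ k)%N by rewrite orderE (transitive_abelian_card x0).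
have semiA h x : h \in A -> h x = x -> h = 1.
  exact: transitive_abelian_semiregular.
have semiT i x : (T ^+ i) x = x -> T ^+ i = 1.
  by apply: (transitive_abelian_semiregular cTT trT); rewrite mem_cycle.
have nAcT : <[T]> \subset 'N(A) by rewrite cycle_subG.
pose P := (A <*> <[T]>)%G.
have pA : p.-group A by rewrite /pgroup oA pnatX pnat_id.
have pP : p.-group P.
  by rewrite /= norm_joinEr // pgroupM pA /pgroup -orderE oT pnatX pnat_id.
have nAP : A <| P by rewrite /normal joing_subl join_subG normG.
have PT i : T ^+ i \in P by rewrite mem_gen // inE mem_cycle orbT.
apply: contraT => ncA.
have r2 : 1 < logn p #|'Ohm_1(A)|.
  by rewrite -p_rank_abelian // -rank_pgroup // ltnNge -abelian_rank1_cyclic.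
have [H [sH1 nHP oH]] := normal_pgroup pP (char_normal_trans (Ohm_char 1 A) nAP) r2.
have sHA : H \subset A := subset_trans sH1 (Ohm_sub 1 A).
have abH : p.-abelem H := abelemS sH1 (Ohm1_abelem pA cAA).
have [cHH expH] := abelemP p_pr abH.
have k_gt1 : 1 < k.
  by have := subset_leq_card sHA; rewrite oH oA leq_exp2l.
have cK := central_commutator_order_p2 p_pr pP nHP oH.
(* The elements of <[T]> that send x0 into its H-orbit form a subgroup. *)
pose orbH := orbit 'P H x0; pose L := [set g in <[T]> | g x0 \in orbH].
have gL : group_set L.
  apply/group_setP; split=> [|g1 g2].
    by rewrite inE group1 perm1 orbit_refl.
  rewrite !inE => /andP[T1 /orbitP[h1 H1 e1]] /andP[T2 /orbitP[h2 H2 e2]].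
  rewrite groupM // permM -e1; apply/orbitP; exists (h2 * h1 ^ g2).
    rewrite groupM // memJ_norm // (subsetP (normal_norm nHP)) //.
    by rewrite mem_gen // inE T2 orbT.
  rewrite /= !apermE permM; have -> : h2 x0 = g2 x0 by rewrite -e2.
  by rewrite /conjg !permM permK.
have oL : #|L| = (p ^ 2)%N.
  rewrite -oH.
  have <- : #|orbH| = #|H|.
    rewrite -(card_orbit_stab 'P H x0).
    suff -> : 'C_H[x0 | 'P] = 1 by rewrite cards1 muln1.
    apply/trivgP/subsetP => h /setIP[Hh /astab1P hx]; apply/set1P.
    by apply: semiA hx; apply: (subsetP sHA).
  have inj : {in L &, injective (fun g : {perm X} => g x0)}.
    move=> g1 g2; rewrite !inE => /andP[/cycleP[i ->] _] /andP[/cycleP[j ->] _] e.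
    apply/eqP; rewrite eq_mulgV1; apply/eqP.
    apply: (transitive_abelian_semiregular (x := (T ^+ j) x0) cTT trT).
      by apply: groupM; rewrite ?groupV; apply: mem_cycle.
    by rewrite -permM mulgA (centsP cTT _ (mem_cycle _ _) _ (mem_cycle _ _)) mulgK.
  rewrite -(card_in_imset inj); apply: eq_card => x.
  apply/imsetP/idP => [[g] |xH]; first by rewrite inE => /andP[_ ?] ->.
  have [g gT xg] := atransP2 trT (in_setT x0) (in_setT x).
  by exists g; rewrite // inE gT -apermE -xg.
set q := (p ^ (k - 2))%N.
have oTq : #[T ^+ q] = (p ^ 2)%N.
  rewrite orderXdiv oT; last by rewrite dvdn_exp2l ?leq_subr.
  by rewrite -expnB ?leq_subr ?prime_gt0 // subKn.
have [a Ha Tqa] : exists2 a, a \in H & (T ^+ q) x0 = a x0.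
  have : <[T ^+ q]>%G :==: Group gL.
    rewrite (eq_subG_cyclic (cycle_cyclic T)) ?cycle_subG ?mem_cycle //=.
      by rewrite -orderE oTq oL.
    by apply/subsetP=> g; rewrite inE => /andP[].
  move/eqP/setP/(_ (T ^+ q)); rewrite /= cycle_id inE => /esym/andP[_].
  by case/orbitP=> a Ha e; exists a.
have Aa := subsetP sHA a Ha; have Pa := subsetP (normal_sub nHP) a Ha.
pose c := T ^+ q * a^-1.
have cx0 : c x0 = x0 by rewrite permM Tqa permK.
have Pc : c \in P by rewrite groupM ?groupV.
have Kac g : g \in P -> [~ a, g] \in [~: H, P] by move=> Pg; rewrite mem_commg.
have cen g h : g \in P -> h \in P -> commute h [~ a, g].
  by move=> Pg Ph; apply/esym/(centsP cK) => //; apply: Kac.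
have expz : [~ a, c] ^+ 'C(p, 2) = 1.
  have [p2|p_neq2] := eqVneq p 2; last first.
    have /dvdnP[d ->] : p %| 'C(p, 2).
      by apply: prime_dvd_bin; rewrite //= ltn_neqAle eq_sym p_neq2.
    rewrite mulnC expgM expH ?expg1n //.
    by rewrite (subsetP _ _ (Kac c Pc)) // commg_subl normal_norm.
  have k_gt2 : 2 < k by rewrite p2 eqxx in hpk.
  have aTq : [~ a, T ^+ q] = 1.
    have -> : q = (p ^ (k - 3) * p)%N by rewrite /q -expnSr -subSn.
    rewrite expgM commgX; last exact: cen.
    by rewrite expH // (subsetP _ _ (Kac _ (PT _))) // commg_subl normal_norm.
  rewrite (_ : [~ a, c] = 1) ?expg1n //; apply/eqP/commgP.
  apply: commuteM; first by apply/commgP; rewrite aTq.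
  exact/commuteV.
have : (T ^+ (q * p)) x0 = x0.
  have -> : T ^+ (q * p) = (c * a) ^+ p by rewrite mulgKV expgM.
  rewrite expMg_Rmul; [|exact: cen..].
  rewrite expz (expH a Ha) !mulg1 {expz}.
  by elim: (p) => [|i IHi]; rewrite ?perm1 // expgSr permM IHi.
move/semiT/eqP; rewrite -order_dvdn oT /q -expnSr dvdn_Pexp2l //.
by case: (k) k_gt1 => [|[|i]] // _; rewrite subSS subn1 ltnn.
Qed.

(** * Cyclic indecomposable solutions as families of translations *)

Section Solutions.
Variable X : finType.
Implicit Type S : nondeg_pair X.

Lemma sg_comp S x y z : solution S ->
  sg S x (sg S y z) = sg S (sg S x y) (sg S (tu S y x) z).
Proof. by case/and3P=> _ /forallP/(_ (x, y, z))/eqP[]. Qed.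

Lemma sg_tu S x y : solution S -> sg S (sg S x y) (tu S y x) = x.
Proof. by case/and3P=> _ _ /forallP/(_ (x, y))/eqP[]. Qed.

Lemma sg_in_permutation_group S x : sg S x \in permutation_group S.
Proof. by apply: mem_gen; apply: imset_f. Qed.

(** The guitar map (x, y, z) |-> (x, sigma_x(y), sigma_x(sigma_y(z))) is injective
    and conjugates r x id and id x r to the two adjacent transpositions of
    coordinates, which satisfy the braid relation. *)
Lemma solution_of_sg_tu S : 0 < #|X| ->
  (forall x y, sg S (sg S x y) (tu S y x) = x) ->
  (forall x y z, sg S x (sg S y z) = sg S (sg S x y) (sg S (tu S y x) z)) ->
  solution S.
Proof.
move=> X0 inv comp.
have invol : involutive (ybmap S).
  case=> x y; rewrite /ybmap /= inv; congr pair.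
  by apply: (@perm_inj _ (sg S x)); rewrite -{1}(inv x y) inv.
apply/and3P; split=> //; last by apply/forallP=> u; rewrite invol.
pose guitar (u : X * X * X) :=
  (u.1.1, sg S u.1.1 u.1.2, sg S u.1.1 (sg S u.1.2 u.2)).
have guitar_inj : injective guitar.
  by move=> [[x y] z] [[x' y'] z'] [] <- /perm_inj <- /perm_inj/perm_inj <-.
pose swap12 (u : X * X * X) := (u.1.2, u.1.1, u.2).
pose swap23 (u : X * X * X) := (u.1.1, u.2, u.1.2).
have g12 u : guitar (ybmap_x_id S u) = swap12 (guitar u).
  by case: u => [[x y] z]; rewrite /guitar /= inv -comp.
have g23 u : guitar (id_x_ybmap S u) = swap23 (guitar u).
  by case: u => [[x y] z]; rewrite /guitar /= inv.
by apply/forallP=> u; apply/eqP/guitar_inj; rewrite !(g12, g23).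
Qed.

End Solutions.

Section Transport.
Variable m : nat.
Local Notation R := 'I_m.+2.
Local Open Scope ring_scope.

(** The points are numbered along the orbit of 0 under a generator g of the
    permutation group, f(i) = g^i(0), and g^s(i) is the permutation attached to
    f(i).  Injectivity of x - s(x) reflects that of tau_v, because (x, x - s(x))
    is a fixed point of r in these coordinates; the closing property of s is
    indecomposability. *)
Lemma cyclic_solution_translations (S : nondeg_pair R) :
  S \in cyclic_indecomposable_solutions R ->
  exists (f : {perm R}) (s : R -> R),
    [/\ forall x y, sg S (f x) (f y) = f (y + s x),
        forall x y, s x + s (y - s x) = s y + s (x - s y),
        injective (fun x => x - s x)
      & forall U : {set R}, 0 \in U -> (forall x y, y \in U -> y + s x \in U) ->
          U = setT].
Proof.
rewrite inE => /and3P[solS trS cycS]; set G := permutation_group S in trS cycS.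
have cGG := cyclic_abelian cycS.
have [g defG] := cyclicP cycS.
have cardG : #[g]%g = m.+2.
  by rewrite orderE -defG (transitive_abelian_card ord0 cGG trS) card_ord.
pose f0 (x : R) : R := (g ^+ x)%g ord0.
have gG i : (g ^+ i)%g \in G by rewrite /= defG mem_cycle.
have gpow_inj (i j : nat) : (g ^+ i)%g ord0 = (g ^+ j)%g ord0 -> i = j %[mod m.+2].
  move=> eqij; apply/eqP; rewrite -cardG -eq_expg_mod_order eq_mulgV1; apply/eqP.
  apply: (transitive_abelian_semiregular (x := (g ^+ j)%g ord0) cGG trS).
    by rewrite groupM ?groupV.
  by rewrite -permM mulgA (centsP cGG _ (gG j) _ (gG i)) -mulgA mulgV mulg1.
have g_mod i : (g ^+ (i %% m.+2) = g ^+ i)%g.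
  by have := expg_mod_order g i; rewrite cardG.
have f_inj : injective f0.
  by move=> i j /gpow_inj; rewrite !modn_small // => /val_inj.
pose f := perm f_inj.
have fE x : f x = (g ^+ x)%g ord0 by rewrite permE.
have /fin_all_exists[s sE] x : exists i : R, sg S (f x) = (g ^+ i)%g.
  have := sg_in_permutation_group S (f x); rewrite -/G /= defG => /cycleP[i ->].
  by exists (inZp i); rewrite /= g_mod.
have sgE x y : sg S (f x) (f y) = f (y + s x).
  by rewrite sE !fE -permM -expgD g_mod.
have tuE x y : tu S (f y) (f x) = f (x - s (y + s x)).
  apply: (@perm_inj _ (sg S (f (y + s x)))).
  have -> : sg S (f (y + s x)) (f (x - s (y + s x))) = f x by rewrite sgE subrK.
  by rewrite -sgE sg_tu.
exists f, s; split=> // [x y||U U0 Us].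
- have := sg_comp (f x) (f (y - s x)) (f 0) solS.
  rewrite tuE !sgE subrK !add0r => /perm_inj.
  by rewrite addrC => ->; rewrite addrC.
- move=> x x' eqD; set v := x - s x in eqD.
  have vx : tu S (f v) (f x) = f v by rewrite tuE subrK.
  have vx' : tu S (f v) (f x') = f v by rewrite tuE [v]eqD subrK.
  by apply/(@perm_inj _ f)/(@perm_inj _ (tu S (f v))); rewrite vx vx'.
(* f(U) is stable under all sigma_x, hence under G. *)
have sub : G \subset 'N(f @: U | 'P)%g.
  rewrite gen_subG; apply/subsetP => _ /imsetP[y _ ->]; apply/astabsP => z /=.
  have Hinv (V : {set R}) (h : {perm R}) : (forall z, z \in V -> h z \in V) ->
      forall z, (h z \in V) = (z \in V).
    move=> hV {}z; apply/idP/idP; last exact: hV.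
    have hVV : h @: V = V.
      apply/eqP; rewrite eqEcard card_imset ?leqnn ?andbT; last exact: perm_inj.
      by apply/subsetP=> _ /imsetP[w Vw ->]; apply: hV.
    by rewrite -{1}hVV => /imsetP[w Vw /perm_inj ->].
  apply: Hinv => _ /imsetP[w Uw ->].
  by rewrite -(permKV f y) sgE imset_f // Us.
apply/eqP; rewrite eqEsubset subsetT; apply/subsetP => x _.
have [h Gh fx] := atransP2 trS (in_setT (f 0)) (in_setT (f x)).
rewrite -(mem_imset _ _ (@perm_inj _ f)) fx.
by rewrite (astabsP (subsetP sub h Gh)) imset_f.
Qed.

End Transport.

(** * q-integers in the ring of residues modulo p^k *)

Section QRing.
Variables (m p k : nat).
Hypotheses (p_pr : prime p) (mE : m.+2 = (p ^ k)%N) (k_ge : (unip_level p <= k)%N).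
Local Notation R := 'I_m.+2.
Local Open Scope ring_scope.
Implicit Types (t x y : R).

Lemma natr_val x : (x : nat)%:R = x.
Proof. by rewrite Zp_nat valZpK. Qed.

Lemma val_natr a : ((a%:R : R) : nat) = (a %% m.+2)%N.
Proof. by rewrite Zp_nat. Qed.

Lemma k_gt0 : (0 < k)%N.
Proof. exact: leq_trans k_ge. Qed.

Lemma eqr_natE (a b : nat) : (a%:R == b%:R :> R) = (a == b %[mod p ^ k]).
Proof. by rewrite -mE -val_eqE /= !val_natr. Qed.

Lemma natr_eq0 (a : nat) : (a%:R == 0 :> R) = (p ^ k %| a)%N.
Proof. by rewrite (eqr_natE a 0) mod0n. Qed.

Lemma val_modn e a : (e <= k)%N -> ((a%:R : R) : nat) = a %[mod p ^ e].
Proof. by move=> le_ek; rewrite val_natr modn_dvdm // mE dvdn_exp2l. Qed.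

Definition pdvd x := (p %| (x : nat))%N.

Lemma pdvd_natr a : pdvd a%:R = (p %| a)%N.
Proof. by rewrite /pdvd /dvdn -(expn1 p) val_modn ?k_gt0. Qed.

Lemma pdvdD x y : pdvd x -> pdvd y -> pdvd (x + y).
Proof. by rewrite -(natr_val x) -(natr_val y) -natrD !pdvd_natr; apply: dvdn_add. Qed.

Lemma pdvdMr x y : pdvd x -> pdvd (x * y).
Proof. by rewrite -(natr_val x) -(natr_val y) -natrM !pdvd_natr; apply: dvdn_mulr. Qed.

Lemma unit_pdvd x : (x \is a GRing.unit) = ~~ pdvd x.
Proof.
rewrite qualifE /= /pdvd; move: (x : nat) => a.
by rewrite mE coprime_pexpl ?k_gt0 // prime_coprime.
Qed.

Lemma unit_1sub x : pdvd x -> 1 - x \is a GRing.unit.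
Proof.
move=> px; rewrite unit_pdvd; apply/negP => /pdvdD/(_ px).
rewrite subrK -(natr_val 1) pdvd_natr /= modn_small ?dvdn1 //.
by case: (p) p_pr => [|[|]].
Qed.

Definition qnum t (d : nat) : R := \sum_(i < d) t ^+ i.

Lemma qnum_nat t d : qnum t d = (qnat t d)%:R.
Proof.
rewrite /qnum /qnat natr_sum; apply: eq_bigr => i _.
by rewrite natrX natr_val.
Qed.

Lemma qnumD t a b : qnum t (a + b) = qnum t a + t ^+ a * qnum t b.
Proof.
rewrite /qnum big_split_ord /= big_distrr /=; congr (_ + _).
by apply: eq_bigr => i _; rewrite exprD.
Qed.

Lemma qnum0 t : qnum t 0 = 0. Proof. by rewrite /qnum big_ord0. Qed.
Lemma qnum1 t : qnum t 1 = 1. Proof. by rewrite /qnum big_ord1. Qed.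

Lemma qnumS t d : qnum t d.+1 = 1 + t * qnum t d.
Proof. by rewrite -[d.+1]add1n qnumD qnum1 expr1. Qed.

Lemma qnum_telescope t d : (t - 1) * qnum t d = t ^+ d - 1.
Proof. by rewrite subrX1. Qed.

Section Unipotent.
Variable t : R.
Hypothesis t1 : unipotent_mod p t.

Lemma qnum_eq0 d : (qnum t d == 0) = (p ^ k %| d)%N.
Proof. by rewrite qnum_nat natr_eq0 dvdn_qnat. Qed.

Lemma pdvd_qnum d : pdvd (qnum t d) = (p %| d)%N.
Proof.
by rewrite qnum_nat pdvd_natr /dvdn (qnat_modn _ (unipotent_modW t1)).
Qed.

Lemma unit_qnum (a : R) : (qnum t a \is a GRing.unit) = (a \is a GRing.unit).
Proof. by rewrite !unit_pdvd pdvd_qnum. Qed.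

Lemma pdvd_unip : pdvd (t - 1).
Proof.
have t_gt0 : (0 < t)%N.
  rewrite lt0n; apply/eqP => t0; have := unipotent_modW t1.
  by rewrite t0 mod0n modn_small ?prime_gt1.
rewrite -(natr_val t) (_ : 1 = 1%:R) // -natrB // pdvd_natr.
by rewrite -eqn_mod_dvd //; apply/eqP/unipotent_modW.
Qed.

Lemma unip_expn : t ^+ m.+2 = 1.
Proof.
apply/eqP; rewrite -subr_eq0 -qnum_telescope.
by have /eqP-> : qnum t m.+2 == 0; rewrite ?mulr0 // qnum_eq0 mE.
Qed.

Lemma unip_expn_mod i : t ^+ (i %% m.+2) = t ^+ i.
Proof. exact: expr_mod unip_expn. Qed.

Lemma unip_unit i : t ^+ i \is a GRing.unit.
Proof.
apply: unitrX; apply/unitrP; exists (t ^+ m.+1).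
by rewrite -exprSr -exprS unip_expn.
Qed.

Lemma unip_expD x y : t ^+ (x + y)%R = t ^+ x * t ^+ y.
Proof. by rewrite /= unip_expn_mod exprD. Qed.

Lemma qnum_mod i : qnum t (i %% m.+2) = qnum t i.
Proof.
rewrite {2}(divn_eq i m.+2) addnC qnumD.
have /eqP-> : qnum t (i %/ m.+2 * m.+2) == 0 by rewrite qnum_eq0 mE dvdn_mull.
by rewrite mulr0 addr0.
Qed.

Lemma qnum_ordD x y : qnum t (x + y)%R = qnum t x + t ^+ x * qnum t y.
Proof. by rewrite -qnumD /= qnum_mod. Qed.

(** If [x]_t = [y]_t with x <= y, then t^x [y - x]_t = 0, so that p^k divides
    y - x. *)
Lemma qnum_inj : injective (fun x : R => qnum t x).
Proof.
have wl x y : (x <= y)%N -> qnum t x = qnum t y -> x = y.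
  move=> le_xy; rewrite -{1}(subnKC le_xy) qnumD -{1}[qnum t x]addr0 => /addrI/esym.
  move/eqP; rewrite mulrI_eq0; last exact/mulrI/unip_unit.
  rewrite qnum_eq0 -mE => dv; apply/val_inj/eqP; rewrite /= eqn_leq le_xy /=.
  rewrite -subn_eq0; case: posnP dv => // gt0 /(dvdn_leq gt0).
  by rewrite leqNgt (leq_ltn_trans (leq_subr x y)).
move=> x y e; case/orP: (leq_total x y) => le; first exact: wl.
by apply/esym/wl.
Qed.

Lemma qnum_surj y : exists x : R, qnum t x = y.
Proof.
have [g _ gK] := injF_bij qnum_inj.
by exists (g y); apply: gK.
Qed.

End Unipotent.

(** * The exponential equation satisfied by the translations *)

Definition exponential_solution t w (s : R -> R) : Prop :=
  forall x, w * qnum t (s x) = t ^+ x.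

Definition shift : {perm R} := perm (addIr 1).

Lemma shiftE x : shift x = x + 1. Proof. by rewrite permE. Qed.

Lemma shiftX i x : (shift ^+ i)%g x = x + i%:R.
Proof.
elim: i => [|i IHi]; first by rewrite perm1 addr0.
by rewrite expgSr permM IHi shiftE -addrA -natr1.
Qed.

Lemma shift_transitive : [transitive <[shift]>, on [set: R] | 'P].
Proof.
apply/imsetP; exists (0 : R); rewrite ?inE //; apply/esym/setP => x.
rewrite inE; apply/orbitP; exists (shift ^+ x)%g; first exact: mem_cycle.
by rewrite /= apermE shiftX add0r natr_val.
Qed.

Section Logarithm.
Hypothesis hpk : (p != 2%N) || (2 < k)%N.
Variable s : R -> R.
Hypothesis s_comm : forall x y, s x + s (y - s x) = s y + s (x - s y).
Hypothesis s_inj : injective (fun x => x - s x).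
Hypothesis s_gen : forall U : {set R}, 0 \in U ->
  (forall x y, y \in U -> y + s x \in U) -> U = setT.

(** This is the passage from s to its parameters: A z are the commuting
    permutations x |-> x + s(z - x), E is the logarithm to base A 0 of the
    regular group that they generate, t0 is the exponent by which the unit
    translation acts on that group, and w = E 1. *)
Lemma translation_parameters : exists t w : R,
  [/\ unipotent_mod p t, w \is a GRing.unit & exponential_solution t w s].
Proof.
have A_inj z : injective (fun x : R => x + s (z - x)).
  have eA x : x + s (z - x) = z - (z - x - s (z - x)) by ring.
  by move=> x x'; rewrite !eA => /addrI/oppr_inj/s_inj/addrI/oppr_inj.
pose A z := perm (A_inj z).
have AE z x : A z x = x + s (z - x) by rewrite permE.
pose T := shift; have TE : forall x, T x = x + 1 by apply: shiftE.
have TX : forall i x, (T ^+ i)%g x = x + i%:R by apply: shiftX.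
have TVE x : (T^-1)%g x = x - 1 by apply: (@perm_inj _ T); rewrite permKV TE subrK.
have AT z : (A z ^ T = A (z + 1))%g.
  apply/permP => x; rewrite /conjg !permM TVE TE !AE addrAC subrK.
  by rewrite opprB addrA.
pose G := <<[set A z | z : R]>>%G.
have GA z : A z \in G by apply/mem_gen/imset_f.
have cGG : abelian G.
  rewrite abelian_gen; apply/centsP => _ /imsetP[z _ ->] _ /imsetP[w _ ->].
  apply/permP => x; rewrite !permM !AE.
  have eD v u : u - (x + s v) = u - x - s v by ring.
  by rewrite !eD -[LHS]addrA -[RHS]addrA s_comm.
have nGT : T \in 'N(G)%g.
  rewrite inE -genJ gen_subG; apply/subsetP => _ /imsetP[_ /imsetP[z _ ->] ->].
  by rewrite /= AT; apply: GA.
have trG : [transitive G, on [set: R] | 'P].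
  apply/imsetP; exists (0 : R); rewrite ?inE //; apply/esym/s_gen.
    exact: orbit_refl.
  move=> x y /orbitP[h Gh <-]; apply/orbitP; exists (h * A (x + h 0)%R)%g.
    by rewrite groupM.
  by rewrite /= !apermE permM AE addrK.
have cycG : cyclic G.
  apply: (regular_abelian_cyclic p_pr _ hpk cGG trG nGT shift_transitive).
  by rewrite card_ord mE.
(* Subgroups of a cyclic normal subgroup are normalised as well. *)
have GT i : (T ^+ i)%g \in 'N(<[A 0]>)%g.
  have chA : <[A 0]> \char G by rewrite sub_cyclic_char // cycle_subG.
  rewrite -cycle_subG (char_norm_trans chA) // cycle_subG.
  exact: groupX.
have ATX z : (A 0 ^ (T ^+ (z : R)) = A z)%g.
  apply/permP => x; rewrite /conjg !permM AE TX.
  have -> : (T ^- z)%g x = x - z.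
    by apply: (@perm_inj _ (T ^+ z)%g); rewrite permKV TX natr_val subrK.
  by rewrite AE natr_val addrAC subrK; congr (_ + s _); ring.
have defG : G :=: <[A 0]>%g.
  apply/eqP; rewrite eqEsubset cycle_subG GA andbT gen_subG.
  apply/subsetP => _ /imsetP[z _ ->].
  by rewrite -ATX memJ_norm ?cycle_id.
have oA : #[A 0]%g = m.+2.
  by rewrite orderE -defG (transitive_abelian_card ord0 cGG trG) card_ord.
have A_inj0 i j : (A 0 ^+ i)%g 0 = (A 0 ^+ j)%g 0 -> i%:R = j%:R :> R.
  move=> e; apply/eqP; rewrite eqr_natE -mE.
  have := eq_expg_mod_order (A 0) i j; rewrite oA => <-.
  rewrite eq_mulgV1; apply/eqP.
  apply: (transitive_abelian_semiregular (x := (A 0 ^+ j)%g 0) cGG trG).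
    by rewrite groupM ?groupV ?groupX.
  by rewrite -permM mulgA (centsP cGG _ (groupX j (GA 0)) _ (groupX i (GA 0))) mulgK.
have /fin_all_exists[E EE] x : exists e : R, (A 0 ^+ e)%g 0 = x.
  have [h] := atransP2 trG (in_setT 0) (in_setT x); rewrite defG => /cycleP[i ->] ->.
  exists i%:R; rewrite val_natr.
  by have := expg_mod_order (A 0) i; rewrite oA => ->.
have E_eq i x : (A 0 ^+ i)%g 0 = x -> E x = i%:R.
  by move=> e; rewrite -(natr_val (E x)); apply: A_inj0; rewrite EE.
have /cycleP[t0 At0] : (A 0 ^ T \in <[A 0]>)%g.
  by have := GT 1%N; rewrite expg1 => nT; rewrite memJ_norm ?cycle_id.
have AtX i z : ((A 0 ^+ i) ^ (T ^+ z) = A 0 ^+ (i * t0 ^ z))%g.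
  elim: z => [|z IHz]; first by rewrite conjg1 muln1.
  by rewrite expgSr conjgM IHz conjXg At0 -expgM mulnCA expnS.
have Es z : E (s z) = t0%:R ^+ z.
  rewrite -natrX; apply: E_eq; rewrite -[(t0 ^ z)%N]mul1n -AtX expg1 ATX AE.
  by rewrite subr0 add0r.
have ES x : E (x + 1) = E 1 + E x * t0%:R.
  rewrite -[E 1]natr_val -[E x]natr_val -natrM -natrD; apply: E_eq.
  rewrite expgD permM EE -[t0]expn1 -AtX expg1 /conjg !permM TVE subrr EE.
  by rewrite TE.
have E0 : E 0 = 0 by apply: (E_eq 0%N); rewrite perm1.
have EX i : E i%:R = E 1 * qnum t0%:R i.
  elim: i => [|i IHi]; first by rewrite qnum0 mulr0 E0.
  by rewrite -natr1 ES IHi qnumS; ring.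
have E_inj : injective E by move=> x y e; rewrite -(EE x) e EE.
have E_surj y : exists x, E x = y.
  by have [g _ gK] := injF_bij E_inj; exists (g y).
(* 1 is a multiple of E 1, by surjectivity of E. *)
have w_unit : E 1 \is a GRing.unit.
  have [x] := E_surj 1; rewrite -[x]natr_val EX => e; apply/unitrPr.
  by exists (qnum t0%:R x).
exists t0%:R, (E 1); split=> // [|x]; last by rewrite -EX natr_val Es.
  (* t0^(p^k) = 1 because the unit translation has order p^k; modulo p, taking
     p-th powers changes nothing. *)
  have tp : t0 = 1 %[mod p].
    have tn : (t0 ^ p ^ k)%N%:R = 1%:R :> R.
      apply: A_inj0; rewrite -[(t0 ^ _)%N]mul1n -AtX expg1.
      rewrite (_ : (T ^+ (p ^ k) = 1)%g) ?conjg1 //; apply/permP => x.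
      rewrite TX perm1 -mE (_ : m.+2%:R = 0) ?addr0 //.
      by apply/eqP; rewrite natr_eq0 mE.
    move/eqP: tn; rewrite eqr_natE => /eqP tn.
    have : t0 ^ p ^ k = 1 %[mod p].
      have := congr1 (modn^~ p) tn; rewrite /= !modn_dvdm //;
        exact/dvdn_exp/dvdnn/k_gt0.
    elim: (k) => [|i IHi]; first by rewrite expn1.
    by rewrite expnSr expnM fermat_little.
  rewrite /unipotent_mod /unip_level val_modn //.
  have [p2|p_neq2] := eqVneq p 2; last by rewrite expn1.
  have k_gt2 : (2 < k)%N by move: hpk; rewrite p2.
  rewrite p2 in tp *.
  have t4 : (t0 = 1 %[mod 4]) \/ (t0 = 3 %[mod 4]).
    have t2 : (t0 %% 4 %% 2 = 1)%N by rewrite modn_dvdm.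
    have : (t0 %% 4 < 4)%N by rewrite ltn_mod.
    by case: (t0 %% 4)%N t2 => [|[|[|[|]]]] //; auto.
  (* Surjectivity of E makes 2 a value of [x]_t, which is impossible for t = 3
     mod 4. *)
  case: t4 => // t3; exfalso.
  have dv4 : (2 ^ 2 %| p ^ k)%N by rewrite p2 dvdn_exp2l // ltnW.
  have [x] := E_surj (E 1 * 2%:R); rewrite -[x]natr_val EX qnum_nat.
  move/(mulrI w_unit)/eqP; rewrite eqr_natE => /eqP/(congr1 (modn^~ (2 ^ 2)%N)) /=.
  rewrite !modn_dvdm // qnat_mod4; first by case: odd.
  by rewrite val_natr mE modn_dvdm.
Qed.

End Logarithm.

(** * Solutions of the exponential equation and their isomorphisms *)

(** Applying x |-> w [x]_t to either side gives the symmetric expression t^x + t^y. *)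
Lemma exponential_comm t w s : unipotent_mod p t -> w \is a GRing.unit ->
  exponential_solution t w s -> forall x y, s x + s (y - s x) = s y + s (x - s y).
Proof.
move=> t1 wU ws.
have key x y : w * qnum t (s x + s (y - s x))%R = t ^+ x + t ^+ y.
  by rewrite qnum_ordD // mulrDr ws mulrCA ws -unip_expD // [s x + _]addrC subrK.
move=> x y; apply: (qnum_inj t1); apply: (mulrI wU).
by rewrite [LHS]key [RHS]key addrC.
Qed.

(** If x - s(y + s(x)) = v, then z = y + s(x) and x = v + s(z) are related by two
    equations that are linear in [x]_t and [z]_t, with coupling coefficients
    divisible by t - 1.  Their determinant is a unit since t - 1 is divisible by p,
    so v and y determine x. *)
Lemma exponential_tau_inj t w s : unipotent_mod p t -> w \is a GRing.unit ->
  exponential_solution t w s -> forall y, injective (fun x => x - s (y + s x)).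
Proof.
move=> t1 wU ws y x x' /=; set v := x - _ => e.
have tX z : t ^+ (z : R) = 1 + (t - 1) * qnum t z by rewrite qnum_telescope addrC subrK.
have Ex a : a - s (y + s a) = v -> w * qnum t a =
    w * qnum t v + t ^+ v * (1 + (t - 1) * qnum t (y + s a)%R).
  move=> av; rewrite -tX -(ws (y + s a)) mulrCA -mulrDr -qnum_ordD //.
  by rewrite -av subrK.
have Ez a : w * qnum t (y + s a)%R =
    w * qnum t y + t ^+ y * (1 + (t - 1) * qnum t a).
  by rewrite qnum_ordD // mulrDr mulrCA ws -tX.
apply: (qnum_inj t1); apply/eqP; rewrite -subr_eq0; apply/eqP.
set d := qnum t x - qnum t x'.
have ux := Ex _ (erefl v); have ux' := Ex _ (esym e).
have c0 : w * w * d = (t - 1) * (t ^+ v * t ^+ y * (t - 1)) * d.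
  transitivity (w * (w * qnum t x) - w * (w * qnum t x')); first by rewrite /d; ring.
  rewrite ux ux'.
  transitivity (t ^+ v * (t - 1) * (w * qnum t (y + s x)%R)
    - t ^+ v * (t - 1) * (w * qnum t (y + s x')%R)); first by ring.
  by rewrite !Ez /d; ring.
have c1 : (1 - (t - 1) * (t ^+ v * t ^+ y * (t - 1) * w^-1 * w^-1)) * d = 0.
  rewrite mulrBl mul1r [_ * _ * d](_ : _ = w^-1 * w^-1 *
    ((t - 1) * (t ^+ v * t ^+ y * (t - 1)) * d)); last by ring.
  by rewrite -c0 !mulrA divrK // mulVr // mul1r subrr.
apply: (mulrI (unit_1sub (pdvdMr _ (pdvd_unip t1)))); rewrite mulr0.
exact: c1.
Qed.

Lemma exponential_unit t w s x : unipotent_mod p t ->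
  exponential_solution t w s -> s x \is a GRing.unit.
Proof.
move=> t1 ws; rewrite unit_pdvd; apply/negP => ps.
have := unip_unit t1 x; rewrite unit_pdvd -ws mulrC pdvdMr //.
by rewrite pdvd_qnum.
Qed.

(** Since s(0) is a unit, sigma_0 alone generates the whole group of translations,
    which is cyclic and transitive. *)
Lemma exponential_solution_exists t w : unipotent_mod p t -> w \is a GRing.unit ->
  exists2 S, S \in cyclic_indecomposable_solutions R &
    exists2 s, (forall x y, sg S x y = y + s x) & exponential_solution t w s.
Proof.
move=> t1 wU.
have /fin_all_exists[s sE] x : exists e : R, qnum t e = w^-1 * t ^+ x.
  exact: qnum_surj.
have ws : exponential_solution t w s by move=> x; rewrite sE mulVKr.
have tau_inj := exponential_tau_inj t1 wU ws.
pose S : nondeg_pair R :=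
  ([ffun x => perm (addIr (s x))], [ffun y => perm (tau_inj y)]).
have sgE x y : sg S x y = y + s x by rewrite /sg ffunE permE.
have tuE x y : tu S y x = x - s (y + s x) by rewrite /tu ffunE permE.
have defG : permutation_group S :=: <[shift]>%g.
  have sgX x : sg S x = (shift ^+ s x)%g.
    by apply/permP => y; rewrite sgE shiftX natr_val.
  apply/eqP; rewrite eqEsubset gen_subG cycle_subG; apply/andP; split.
    by apply/subsetP => _ /imsetP[x _ ->]; rewrite sgX mem_cycle.
  have -> : shift = (sg S 0%R ^+ (s 0)^-1%R)%g.
    apply/permP => x; rewrite sgX -expgM shiftE shiftX natrM !natr_val.
    by rewrite mulrV //; apply: exponential_unit t1 ws.
  exact/groupX/sg_in_permutation_group.
exists S; last by exists s.
rewrite inE /indecomposable defG shift_transitive cycle_cyclic !andbT.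
apply: solution_of_sg_tu => [|x y|x y z]; first by rewrite card_ord.
  by rewrite !sgE tuE subrK.
rewrite !sgE tuE -!addrA; congr (_ + _).
have := exponential_comm t1 wU ws x (y + s x); rewrite addrK [s y + _]addrC => ->.
by rewrite addrC.
Qed.

(** Iterating a(x) = x + s(-x) from 0 reaches x after w [x]_t steps, a number that
    depends on s only.  So x |-> w [x]_t is determined by s; its value at 1 is w,
    and its value at s(1) is t. *)
Lemma exponential_unique t w t' w' s : unipotent_mod p t -> unipotent_mod p t' ->
  exponential_solution t w s -> exponential_solution t' w' s -> t = t' /\ w = w'.
Proof.
move=> t1 t1' ws ws'.
pose a (x : R) := x + s (- x).
have step (u v x : R) : unipotent_mod p u -> exponential_solution u v s ->
    v * qnum u (a x) = v * qnum u x + 1.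
  move=> u1 us; rewrite qnum_ordD // mulrDr; congr (_ + _).
  by rewrite mulrCA us -unip_expD // subrr.
have iterE (u v : R) i : unipotent_mod p u -> exponential_solution u v s ->
    v * qnum u (iter i a 0) = i%:R.
  by move=> u1 us; elim: i => [|i IHi] /=; rewrite ?qnum0 ?mulr0 // step // IHi natr1.
have vU (u v : R) : unipotent_mod p u -> exponential_solution u v s ->
    v \is a GRing.unit.
  by move=> u1 us; have := unip_unit u1 0%N; rewrite -(us 0) unitrM => /andP[].
have qE x : w * qnum t x = w' * qnum t' x.
  have <- : iter (w * qnum t x)%R a 0 = x.
    apply: (qnum_inj t1); apply: (mulrI (vU _ _ t1 ws)).
    by rewrite [LHS]iterE // natr_val.
  by rewrite !iterE.
split; last by have := qE 1; rewrite /= !qnum1 !mulr1.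
by have := qE (s 1); rewrite ws ws'.
Qed.

Lemma unipotent_expr t i : unipotent_mod p t -> unipotent_mod p (t ^+ i : R).
Proof.
move=> t1; rewrite -(natr_val t) -natrX /unipotent_mod val_modn //.
exact: unipotent_modX.
Qed.

Lemma qnumM t a b : qnum t (a * b) = qnum t a * qnum (t ^+ a) b.
Proof.
elim: b => [|b IHb]; first by rewrite muln0 !qnum0 mulr0.
by rewrite mulnS qnumD IHb qnumS mulrDr mulr1 mulrCA.
Qed.

(** The affine map y |-> a y + b carries the parameters (t, w) to (t', w'). *)
Definition affinely_equivalent t w t' w' : Prop :=
  exists2 a : R, a \is a GRing.unit &
    exists b : R, t' ^+ a = t /\ w * t' ^+ b = qnum t' a * w'.

(** An isomorphism f satisfies f(y + s(0)) = f(y) + s'(f(0)) for all y, and s(0) is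
    a unit, so f is affine.  For f(x) = a x + b the condition a s(x) = s'(f(x))
    says that s also solves the equation with parameters t'^a and
    [a]_t' w' / t'^b, which must then be t and w. *)
Lemma isomorphic_exponentialP S S' s s' t w t' w' :
  unipotent_mod p t -> unipotent_mod p t' ->
  w \is a GRing.unit -> w' \is a GRing.unit ->
  (forall x y, sg S x y = y + s x) -> (forall x y, sg S' x y = y + s' x) ->
  exponential_solution t w s -> exponential_solution t' w' s' ->
  (isomorphic S S' <-> affinely_equivalent t w t' w').
Proof.
move=> t1 t1' wU wU' sE sE' ws ws'.
have expM (a x b : R) : t' ^+ (a * x + b)%R = (t' ^+ a) ^+ x * t' ^+ b.
  by rewrite unip_expD //= unip_expn_mod // exprM.
have qM (a x : R) : qnum t' (a * x)%R = qnum t' a * qnum (t' ^+ a) x.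
  by rewrite /= qnum_mod // qnumM.
split=> [/existsP[f /forallP fE] | [a aU [b [ta wb]]]]; last first.
  have f_inj : injective (fun x => a * x + b) by move=> x y /addIr/(mulrI aU).
  apply/existsP; exists (perm f_inj); apply/forallP => x; apply/forallP => y.
  rewrite sE sE' !permE mulrDr addrAC; apply/eqP; congr (_ + _).
  apply: (qnum_inj t1'); apply: (mulrI wU'); rewrite /= qM ws' expM ta mulrA.
  by rewrite [w' * _]mulrC -wb mulrAC ws.
have {}fE x y : f (y + s x) = f y + s' (f x).
  by have /forallP/(_ y)/eqP := fE x; rewrite sE sE'.
have s0U := exponential_unit 0 t1 ws.
pose a := (s 0)^-1 * s' (f 0).
have f_iter i : f ((s 0) *+ i) = f 0 + s' (f 0) *+ i.
  by elim: i => [|i IHi]; rewrite ?mulr0n ?addr0 // !mulrSr fE IHi addrA.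
have f_aff x : f x = a * x + f 0.
  have {1}-> : x = s 0 *+ ((s 0)^-1 * x)%R by rewrite -mulr_natr natr_val mulVKr.
  rewrite f_iter addrC -mulr_natr natr_val; congr (_ + _).
  by rewrite mulrCA mulrA.
have aU : a \is a GRing.unit.
  apply/unitrPr; exists ((f^-1)%g (1 + f 0)).
  by apply: (addIr (f 0)); rewrite -f_aff permKV.
exists a => //; exists (f 0).
have as_ x : a * s x = s' (a * x + f 0).
  by rewrite -f_aff; apply: (addIr (f 0)); rewrite -f_aff -[s x]add0r fE addrC.
have t1a := unipotent_expr a t1'.
have bU : t' ^+ (f 0) \is a GRing.unit by apply: unip_unit.
have ws2 : exponential_solution (t' ^+ a) (w' * qnum t' a * (t' ^+ (f 0))^-1) s.
  by move=> x; rewrite mulrAC -[_ * qnum t' a * _]mulrA -qM as_ ws' expM (mulrK bU).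
have [-> ->] := exponential_unique t1 t1a ws ws2.
by split=> //; rewrite (divrK bU) mulrC.
Qed.

(** * Normal forms of the parameters *)

Lemma modn_prodP e x y : (e <= k)%N ->
  ((x : nat) = y %[mod p ^ e]) <-> exists c, x = y + (p ^ e)%:R * c.
Proof.
move=> le_ek; split=> [xy | [c xE]]; last first.
  have -> : x = (y + p ^ e * c)%N%:R by rewrite natrD natrM !natr_val.
  by rewrite val_modn // addnC mulnC modnMDl.
have /dvdnP[c cE] : (p ^ e %| x + (m.+2 - y))%N.
  rewrite /dvdn -modnDml xy modnDml subnKC; last exact/ltnW/ltn_ord.
  by rewrite mE; apply: dvdn_exp2l.
exists c%:R; rewrite -natrM mulnC -cE natrD natrB; last exact/ltnW/ltn_ord.
have -> : m.+2%:R = 0 :> R by apply/eqP; rewrite natr_eq0 mE.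
by rewrite !natr_val; ring.
Qed.

(** The chosen generator of the group of units that are 1 mod p^j. *)
Definition level_unit j : R := (1 + p ^ j)%:R.

Lemma level_unipotent j : (unip_level p <= j)%N -> unipotent_mod p (level_unit j).
Proof.
move=> lj; rewrite /unipotent_mod val_modn // -(subnK lj) expnD addnC.
by rewrite modnMDl.
Qed.

(** Together with bijectivity of [.]_t, this shows that the powers of 1 + p^j are
    all the residues that are 1 mod p^j. *)
Lemma level_expr j a : level_unit j ^+ a = 1 + (p ^ j)%:R * qnum (level_unit j) a.
Proof.
have -> : (p ^ j)%:R = level_unit j - 1 by rewrite /level_unit natrD addrAC subrr add0r.
by rewrite qnum_telescope addrC subrK.
Qed.

Lemma pexp_mul_le j j' x : (j <= k)%N -> (j' <= k)%N ->
  (p ^ j')%:R * x = (p ^ j)%:R -> (j' <= j)%N.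
Proof.
move=> jk jk' /eqP; rewrite -(natr_val x) -natrM eqr_natE => /eqP e.
have dj : (p ^ j' %| p ^ k)%N by rewrite dvdn_exp2l.
have /(congr1 (modn^~ (p ^ j')%N)) := e.
rewrite /= !modn_dvdm // => {}e.
by rewrite -(dvdn_Pexp2l _ _ (prime_gt1 p_pr)) /dvdn -e modnMr.
Qed.

(** From (1 + p^j')^a = 1 + p^j one gets p^j' [a] = p^j with [a] a unit, so j = j'
    and [a] = 1 mod p^(k-j), while (1 + p^j)^b = 1 mod p^j.  Conversely, a
    congruence of w and w' mod p^j is absorbed by b, and one mod p^(k-j) by a. *)
Lemma level_isoP j j' w w' : (unip_level p <= j <= k)%N ->
  (unip_level p <= j' <= k)%N -> w \is a GRing.unit -> w' \is a GRing.unit ->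
  affinely_equivalent (level_unit j) w (level_unit j') w' <->
  j = j' /\ (w : nat) = w' %[mod p ^ minn j (k - j)].
Proof.
move=> /andP[lj jk] /andP[lj' jk'] wU wU'.
have gE i : level_unit i = 1 + (p ^ i)%:R by rewrite /level_unit natrD.
have minE e (c : R) : (minn j (k - j) <= e)%N ->
    exists d, (p ^ e)%:R * c = (p ^ minn j (k - j))%:R * d.
  by move/subnKC <-; rewrite expnD natrM -mulrA; eexists.
have le_min : (minn j (k - j) <= k)%N by rewrite geq_min jk.
split=> [[a aU [b [ga wb]]] | [<- ww']].
  have g1 := level_unipotent lj'.
  have qaU : qnum (level_unit j') a \is a GRing.unit by rewrite unit_qnum.
  have pa : (p ^ j')%:R * qnum (level_unit j') a = (p ^ j)%:R.
    by move: ga; rewrite level_expr [level_unit j]gE => /addrI.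
  have jj' : j = j'.
    apply/eqP; rewrite eqn_leq (pexp_mul_le jk jk' pa) andbT.
    by apply: (@pexp_mul_le _ _ (qnum (level_unit j') a)^-1); rewrite // -pa mulrK.
  split=> //; rewrite -jj' in pa wb qaU *.
  have qa : (qnum (level_unit j) a : nat) = (1%R : R) %[mod p ^ (k - j)].
    move: pa => /eqP; rewrite -{1}(natr_val (qnum _ a)) -natrM -{2}[(p ^ j)%N]muln1.
    have kE : (p ^ k = p ^ j * p ^ (k - j))%N by rewrite -expnD subnKC.
    rewrite eqr_natE kE -!muln_modr eqn_pmul2l ?expn_gt0 ?prime_gt0 //.
    by move/eqP->; rewrite -(val_modn 1) // leq_subr.
  have /(modn_prodP _ _ (leq_subr j k))[c qaE] := qa.
  rewrite qaE level_expr in wb.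
  have [c1 c1E] := minE _ c (geq_minr j (k - j)).
  have [c2 c2E] := minE _ (qnum (level_unit j) b) (geq_minl j (k - j)).
  apply/modn_prodP => //; exists (c1 * w' - w * c2).
  rewrite c1E c2E in wb.
  apply: (addIr (w * ((p ^ minn j (k - j))%:R * c2))).
  rewrite -{1}[w]mulr1 -mulrDr wb; ring.
have g1 := level_unipotent lj.
(* The smaller of j and k - j decides whether b or a does the work. *)
have /(modn_prodP _ _ le_min)[c wE] := ww'; case: leqP wE => [le|/ltnW le] wE.
  have [b bE] := qnum_surj g1 (- c * w^-1).
  exists 1; rewrite ?unitr1 //; exists b; split; first by rewrite expr1.
  rewrite qnum1 mul1r level_expr bE mulrDr mulr1.
  rewrite -[w' in RHS](addrK ((p ^ j)%:R * c)) -wE.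
  by congr (_ + _); rewrite mulrC -mulrA divrK // mulrN.
have [a aE] := qnum_surj g1 (w * w'^-1).
exists a; first by rewrite -(unit_qnum g1) aE unitrM wU unitrV.
exists 0; split; last by rewrite mulr1 aE divrK.
rewrite level_expr aE wE [level_unit j]gE mulrDl mulrV // mulrDr mulr1.
rewrite !mulrA -natrM -expnD subnKC //.
have -> : (p ^ k)%:R = 0 :> R by apply/eqP; rewrite natr_eq0.
by rewrite !mul0r addr0.
Qed.

(** j is the p-adic valuation of t - 1, and j = k when t = 1. *)
Lemma unipotent_decomp t : unipotent_mod p t ->
  exists j (v : R), [/\ (unip_level p <= j <= k)%N, v \is a GRing.unit &
    t = 1 + (p ^ j)%:R * v].
Proof.
move=> t1; have t_gt0 : (0 < t)%N.
  rewrite lt0n; apply/eqP => t0; have := unipotent_modW t1.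
  by rewrite t0 mod0n modn_small ?prime_gt1.
have tE : t = 1 + (t - 1)%N%:R by rewrite natrB // natr_val addrC subrK.
have [a0 | a_gt0] := posnP (t - 1)%N.
  exists k, 1; rewrite unitr1 leqnn andbT; split=> //.
  rewrite tE a0; have -> : (p ^ k)%:R = 0 :> R by apply/eqP; rewrite natr_eq0.
  by rewrite mul0r.
have [u pu aE] := pfactor_coprime p_pr a_gt0.
exists (logn p (t - 1)), u%:R; split.
- have -> : (unip_level p <= logn p (t - 1))%N.
    by rewrite -pfactor_dvdn // -eqn_mod_dvd //; apply/eqP.
  rewrite -ltnS -(ltn_exp2l _ _ (prime_gt1 p_pr)) expnSr.
  rewrite (leq_ltn_trans (n := t - 1)) //.
    by rewrite dvdn_leq // pfactor_dvdnn.
  rewrite -mE (leq_ltn_trans (leq_subr _ _)) // (leq_trans (ltn_ord t)) //.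
  by rewrite leq_pmulr // prime_gt0.
- by rewrite unit_pdvd pdvd_natr -prime_coprime.
- by rewrite {1}tE {1}aE mulnC natrM.
Qed.

Lemma level_normal_form t w : unipotent_mod p t -> w \is a GRing.unit ->
  exists j (w' : R), [/\ (unip_level p <= j <= k)%N, w' \is a GRing.unit &
    affinely_equivalent t w (level_unit j) w'].
Proof.
move=> t1 wU; have [j [v [jk vU tE]]] := unipotent_decomp t1.
have g1 : unipotent_mod p (level_unit j).
  by case/andP: jk => lj _; apply: level_unipotent.
have [a aE] := qnum_surj g1 v.
exists j, (v^-1 * w); split; rewrite ?unitrM ?unitrV ?vU //.
exists a; first by rewrite -(unit_qnum g1) aE.
by exists 0; split; [rewrite level_expr aE | rewrite mulr1 aE mulVKr].
Qed.

End QRing.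

(** * Counting the isomorphism classes *)

Local Open Scope nat_scope.

Lemma card_equivalence_partition (T I : finType) (e : rel T) (D : {set T})
    (P : {set I}) (rep : I -> T) :
  equivalence_rel e -> {in P, forall i, rep i \in D} ->
  {in P &, forall i j, e (rep i) (rep j) -> i = j} ->
  {in D, forall x, exists2 i, i \in P & e (rep i) x} ->
  #|equivalence_partition e D| = #|P|.
Proof.
move=> eqe repD rep_inj rep_surj.
pose class x := [set y in D | e x y].
have classP x y : x \in D -> y \in D -> (class x == class y) = e x y.
  move=> Dx Dy; apply/eqP/idP => [exy | exy].
    have : y \in class y by rewrite inE Dy (eqe y y y).1.
    by rewrite -exy inE => /andP[].
  by apply/setP => z; rewrite !inE ((eqe x y z).2 exy).
have -> : equivalence_partition e D = (fun i => class (rep i)) @: P.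
  apply/setP => B; apply/imsetP/imsetP => [[x Dx ->] | [i Pi ->]]; last first.
    by exists (rep i) => //; apply: repD.
  have [i Pi eix] := rep_surj x Dx; exists i => //.
  by apply/esym/eqP; rewrite classP // repD.
apply: card_in_imset => i j Pi Pj /= /eqP; rewrite classP ?repD //.
exact: rep_inj.
Qed.

Lemma card_coprime_below n M : M <= n ->
  #|[set i : 'I_n | (i < M) && coprime M i]| = totient M.
Proof.
move=> leMn; rewrite totient_count_coprime big_mkord -sum1dep_card.
rewrite (big_ord_widen_cond _ xpredT (fun i => nat_of_bool (coprime M i)) leMn).
rewrite big_mkcondr [RHS]big_mkcond [LHS]big_mkcond /=; apply: eq_bigr => i _.
by case: (i < M); case: coprime.
Qed.

(** The classes are indexed by pairs (j, i) with i < p^min(j, k-j) prime to p. *)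
Lemma num_cyclic_indecomposableE p k : prime p -> unip_level p <= k ->
  (p != 2) || (2 < k) ->
  num_cyclic_indecomposable (p ^ k) =
    \sum_(j < k.+1 | unip_level p <= j) totient (p ^ minn j (k - j)).
Proof.
move=> p_pr k_ge hpk; have p_gt1 := prime_gt1 p_pr.
have [m mE] : exists m, m.+2 = p ^ k.
  exists (p ^ k - 2); rewrite -addn2 subnK //.
  by rewrite (leq_trans p_gt1) // -{1}(expn1 p) leq_exp2l // (leq_trans _ k_ge).
rewrite /num_cyclic_indecomposable -mE.
pose R := 'I_m.+2; pose M (j : nat) := p ^ minn j (k - j).
have leM j : j <= k -> M j <= m.+2.
  by move=> jk; rewrite mE leq_exp2l // geq_min jk.
pose P := [set q : 'I_k.+1 * R |
  [&& unip_level p <= q.1, q.2 < M q.1 & coprime (M q.1) q.2]].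
have <- : #|P| = \sum_(j < k.+1 | unip_level p <= j) totient (M j).
  rewrite -sum1dep_card big_mkcond -(pair_bigA _ (fun (j : 'I_k.+1) (i : R) =>
    if [&& unip_level p <= j, i < M j & coprime (M j) i] then 1 else 0)) /=.
  rewrite [RHS]big_mkcond /=; apply: eq_bigr => j _.
  case: ifP => _ /=; last by rewrite big1.
  by rewrite -big_mkcond sum1dep_card card_coprime_below // leM // -ltnS.
(* For j = k the modulus is 1 and its only residue is 0, so the unit 1 has to
   stand for it. *)
pose wt (q : 'I_k.+1 * R) : R := if minn q.1 (k - q.1) == 0 then 1%R else q.2.
have Plvl q : q \in P -> unip_level p <= q.1 <= k.
  by rewrite inE => /and3P[-> _ _]; rewrite -ltnS ltn_ord.
have wtU q : q \in P -> wt q \is a GRing.unit.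
  rewrite inE /wt => /and3P[_ _]; case: eqP => [_ _ | /eqP min0].
    exact: GRing.unitr1.
  rewrite (unit_pdvd p_pr mE k_ge) /pdvd /M coprime_pexpl ?lt0n //.
  by rewrite prime_coprime.
have wtM q j (a : R) : q \in P -> q.1 = j :> nat -> a = q.2 %[mod M j] ->
    wt q = a %[mod M j].
  move=> Pq <- aq; rewrite /wt; case: eqP => [min0 | _]; last by rewrite aq.
  by rewrite /M min0 !modn1.
have gU j : unip_level p <= j <= k -> unipotent_mod p (level_unit m p j).
  by case/andP=> lj _; apply: level_unipotent mE k_ge _ _.
have /fin_all_exists[rep repE] q : exists S : nondeg_pair R, q \in P ->
    S \in cyclic_indecomposable_solutions R /\
    exists2 s, (forall x y, sg S x y = (y + s x)%R)
             & exponential_solution (level_unit m p q.1) (wt q) s.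
  have [Pq | _] := boolP (q \in P); last by exists ([ffun=> 1%g], [ffun=> 1%g]).
  have [S CS Ss] :=
    exponential_solution_exists p_pr mE k_ge (gU _ (Plvl q Pq)) (wtU q Pq).
  by exists S.
apply: (@card_equivalence_partition _ _ _ _ P rep).
- exact: isomorphic_equiv.
- by move=> q /repE[].
- move=> q q' Pq Pq'.
  have [_ [s sE ws]] := repE q Pq; have [_ [s' sE' ws']] := repE q' Pq'.
  move/(isomorphic_exponentialP p_pr mE k_ge (gU _ (Plvl q Pq)) (gU _ (Plvl q' Pq'))
    (wtU q Pq) (wtU q' Pq') sE sE' ws ws').
  move/(level_isoP p_pr mE k_ge (Plvl q Pq) (Plvl q' Pq') (wtU q Pq) (wtU q' Pq')).
  case=> ejj eww; move: Pq Pq'; rewrite !inE => /and3P[_ lt _] /and3P[_ lt' _].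
  move: eww; rewrite -/(M _) /wt -ejj => eww; rewrite -ejj in lt'.
  case: q q' ejj eww lt lt' {sE ws sE' ws'} => [j i] [j' i'] /= /val_inj <-.
  case: eqP => [min0 _ | _].
    rewrite /M min0 !ltnS !leqn0 => /eqP i0 /eqP i0'.
    by congr (_, _); apply: val_inj; rewrite /= i0 i0'.
  by move=> e lt lt'; rewrite !modn_small // in e; rewrite (val_inj e).
move=> S CS; have [f [s [fE s_comm s_inj s_gen]]] := cyclic_solution_translations CS.
have [t [w [t1 wU ws]]] := translation_parameters p_pr mE k_ge hpk s_comm s_inj s_gen.
have [S0 CS0 [s0 sE0 ws0]] := exponential_solution_exists p_pr mE k_ge t1 wU.
have iso0 : isomorphic S0 S.
  apply/existsP; exists f; apply/forallP => x; apply/forallP => y.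
  rewrite sE0 fE; apply/eqP; congr (f (_ + _)%R).
  apply: (qnum_inj p_pr mE t1); apply: (GRing.mulrI wU).
  by rewrite /= ws0 ws.
have [j [w' [jk wU' iso1]]] := level_normal_form p_pr mE k_ge t1 wU.
have [S1 CS1 [s1 sE1 ws1]] := exponential_solution_exists p_pr mE k_ge (gU _ jk) wU'.
have isoE := isomorphic_exponentialP p_pr mE k_ge.
have {}iso1 : isomorphic S0 S1.
  exact/(isoE _ _ _ _ _ _ _ _ t1 (gU _ jk) wU wU' sE0 sE1 ws0 ws1).
have [lj le_jk] := andP jk.
pose q : 'I_k.+1 * R := (inord j, inZp (w' %% M j)).
have qj : q.1 = j :> nat by rewrite /= inordK.
have M_gt0 : 0 < M j by rewrite expn_gt0 ltnW.
have qw : q.2 = w' %% M j :> nat.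
  by rewrite /= modn_small // (leq_trans (ltn_pmod _ M_gt0)) // leM.
have Pq : q \in P.
  rewrite inE qj qw lj ltn_pmod //= coprime_modr /M.
  have [-> | min_gt0] := posnP (minn j (k - j)); first exact: coprime1n.
  by rewrite coprime_pexpl // prime_coprime // -/(pdvd p w') -(unit_pdvd p_pr mE k_ge).
exists q => //.
have [_ [s2 sE2 ws2]] := repE q Pq; rewrite qj in ws2.
have iso2 : isomorphic (rep q) S1.
  apply/(isoE _ _ _ _ _ _ _ _ (gU _ jk) (gU _ jk) (wtU q Pq) wU' sE2 sE1 ws2 ws1).
  apply/(level_isoP p_pr mE k_ge jk jk (wtU q Pq) wU'); split=> //.
  by apply: wtM; rewrite // qw modn_mod.
have eqv := @isomorphic_equiv R.
rewrite ((eqv _ _ _).2 iso2).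
by rewrite -((eqv _ _ S).2 iso1).
Qed.

Lemma sum_totient_pfactor p r : prime p -> \sum_(j < r.+1) totient (p ^ j) = p ^ r.
Proof.
move=> p_pr; elim: r => [|r IHr]; first by rewrite big_ord1.
by rewrite big_ord_recr /= IHr totient_pfactor // -mulSn prednK ?prime_gt0 // expnS.
Qed.

(** Up to j = a the minimum is j, and beyond it the minimum runs down from b to 0,
    so that two full sums of totients appear. *)
Lemma sum_totient_minn p a b : prime p -> b <= a <= b.+1 ->
  \sum_(j < (a + b.+1).+1) totient (p ^ minn j (a + b.+1 - j)) = p ^ a + p ^ b.
Proof.
move=> p_pr /andP[le_ba le_ab]; rewrite -addSn big_split_ord /=.
rewrite -(sum_totient_pfactor a p_pr) -(sum_totient_pfactor b p_pr); congr addn.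
  apply: eq_bigr => j _ /=; congr (totient (p ^ _)).
  by apply/minn_idPl; have := ltn_ord j; lia.
rewrite [RHS](reindex_inj rev_ord_inj); apply: eq_bigr => j _ /=.
by congr (totient (p ^ _)); have := ltn_ord j; lia.
Qed.

(** The missing terms, j = 0 and for p = 2 also j = 1, are all equal to 1. *)
Lemma sum_totient_level p a b : prime p -> b <= a <= b.+1 -> unip_level p <= a + b.+1 ->
  \sum_(j < (a + b.+1).+1 | unip_level p <= j) totient (p ^ minn j (a + b.+1 - j)) =
  p ^ a + p ^ b - unip_level p.
Proof.
move=> p_pr ab lk; rewrite -sum_totient_minn // addnS in lk *.
move: (a + b) lk => k lk.
rewrite -(big_geq_mkord _ _ xpredT (fun j => totient (p ^ minn j (k.+1 - j)))).
rewrite -(big_mkord xpredT (fun j => totient (p ^ minn j (k.+1 - j)))).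
rewrite [in RHS](@big_cat_nat _ _ _ (unip_level p)) //=; last exact: leqW.
suff -> : \sum_(0 <= j < unip_level p) totient (p ^ minn j (k.+1 - j)) = unip_level p.
  by rewrite addKn.
rewrite /unip_level in lk *; case: eqVneq lk => [-> | _] lk.
  by rewrite 2?big_nat_recl // big_geq //= min0n (_ : minn 1 _ = 1) //; lia.
by rewrite big_nat1 min0n.
Qed.

Theorem proposition4p1 (p k : nat) (hp : prime p) (hk : 0 < k) :
  [/\ forall r : nat, p != 2 -> k = 2 * r -> 2 <= 2 * r ->
        num_cyclic_indecomposable (p ^ k) = p ^ r + p ^ (r - 1) - 1,
      forall r : nat, p != 2 -> k = 2 * r + 1 -> 3 <= 2 * r + 1 ->
        num_cyclic_indecomposable (p ^ k) = 2 * p ^ r - 1,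
      forall r : nat, p = 2 -> k = 2 * r -> 4 <= 2 * r ->
        num_cyclic_indecomposable (p ^ k) = 2 ^ r + 2 ^ (r - 1) - 2
    & forall r : nat, p = 2 -> k = 2 * r + 1 -> 3 <= 2 * r + 1 ->
        num_cyclic_indecomposable (p ^ k) = 2 ^ (r + 1) - 2].
Proof.
have count a b : k = a + b.+1 -> b <= a <= b.+1 -> (p != 2) || (2 < k) ->
    num_cyclic_indecomposable (p ^ k) = p ^ a + p ^ b - unip_level p.
  move=> -> ab hpk; have lk : unip_level p <= a + b.+1.
    by move: hpk; rewrite /unip_level; case: eqP => //= _; lia.
  by rewrite num_cyclic_indecomposableE // sum_totient_level.
split=> r.
- move=> p2 kE r1; rewrite (count r (r - 1)) ?p2 //; try lia.
  by rewrite /unip_level (negPf p2).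
- move=> p2 kE r1; rewrite (count r r) ?p2 //; try lia.
  by rewrite /unip_level (negPf p2); lia.
- by move=> p2 kE r1; rewrite (count r (r - 1)) ?p2 //; lia.
- move=> p2 kE r1; rewrite (count r r) ?p2 ?leqnn ?leqnSn //; try lia.
  by rewrite /unip_level eqxx addnn -mul2n addn1 expnS.
Qed.
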